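(* Suppose the polynomials $Q_n(x)$ are orthogonal with respect to a nondegenerate linear functional $\tau$, and let $\mathcal R$ be the corresponding reciprocal operator. Let $j\ge1$ be an integer and assume that $\mu_n$ satisfies a linear difference equation with constant coefficients of order $j+1$, $$\alpha_0\mu_n+\alpha_1\mu_{n-1}+\dots+\alpha_{j+1}\mu_{n-j-1}=0,\qquad n>j+1,$$ with $\alpha_0\neq0$, $\alpha_{j+1}\ne0$. Then $\mathcal R$ has no more than $j+2$ diagonals in the monomial basis: $$\mathcal R x^n=\nu_{n+1}x^{n+1}+K_n^{(0)}x^n+K_n^{(1)}x^{n-1}+\dots+K_n^{(j)}x^{n-j},\qquad n\ge0,$$ with some coefficients $K_n^{(k)}$, where $K_n^{(k)}=0$ for $k>n$.
   Context: All polynomials have complex coefficients. A linear functional on polynomials is nondegenerate if all Hankel determinants $\det|m_{i+k}|_{i,k=0}^{n-1}$, $n\ge1$, of its moments $m_n$ are nonzero. $\sigma$ is a nondegenerate linear functional with moments $g_n=\langle\sigma,x^n\rangle$, $g_0=1$, and $P_n(x)=x^n+O(x^{n-1})$ are its monic orthogonal polynomials. A generalized derivative operator $\mathcal D$ is the linear operator on polynomials with $\mathcal D x^n=\mu_n x^{n-1}$, where $\mu_n$ are complex numbers with $\mu_0=0$ and $\mu_n\neq0$ for $n\ge1$. The derived monic polynomials are $Q_n(x)=\mu_{n+1}^{-1}\mathcal D P_{n+1}(x)$, $n\ge 0$. When the $Q_n$ are orthogonal with respect to a nondegenerate functional $\tau$, the reciprocal operator $\mathcal R$ is the unique linear operator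 on polynomials such that $\langle\tau,g\,\mathcal Df\rangle=\langle\sigma,f\,\mathcal Rg\rangle$ for all polynomials $f,g$; it satisfies $\mathcal RQ_n=\nu_{n+1}P_{n+1}$ with nonzero $\nu_{n+1}$ and acts on monomials as $\mathcal Rx^n=\nu_{n+1}x^{n+1}+R_{nn}x^n+\dots+R_{n0}$. *)

(* Defs.v *)
(* Written in MathComp; the complex numbers are R[i] over R : realType. *)
From mathcomp Require Import all_boot all_order all_algebra.
From mathcomp Require Import reals.
From mathcomp Require Import complex.
Set Implicit Arguments.
Unset Strict Implicit.
Unset Printing Implicit Defensive.
Import GRing.Theory Num.Theory.
Local Open Scope ring_scope.

Section OrthogonalPolynomials.
Variable C : fieldType.
Implicit Types (L sigma tau : {scalar {poly C}}) (P Q : nat -> {poly C}).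
Implicit Types (D Rec : {linear {poly C} -> {poly C}}) (mu : nat -> C).

Definition moment L (n : nat) : C := L 'X^n.

Definition nondegenerate_functional L : Prop :=
  forall n : nat, (0 < n)%N ->
    \det (\matrix_(i < n, k < n) moment L (i + k)) != 0.

(* The squared norms L (P n * P n) are not required to be nonzero: this
   follows from nondegeneracy when each P n has degree n. *)
Definition orthogonal_for L P : Prop :=
  forall m n : nat, m <> n -> L (P m * P n) = 0.

Definition monic_orthogonal L P : Prop :=
  (forall n, P n \is monic /\ size (P n) = n.+1) /\ orthogonal_for L P.

(* At n = 0 the last clause reads D 1 = 0, since mu 0 = 0. *)
Definition generalized_derivative mu D : Prop :=
  [/\ mu 0%N = 0,
      forall n, (0 < n)%N -> mu n != 0
    & forall n, D 'X^n = mu n *: 'X^(n.-1)].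

Definition derived_poly mu D P (n : nat) : {poly C} :=
  (mu n.+1)^-1 *: D (P n.+1).

(* Nondegeneracy of sigma makes Rec unique. *)
Definition reciprocal_operator sigma tau D Rec : Prop :=
  forall f g : {poly C}, tau (g * D f) = sigma (f * Rec g).

End OrthogonalPolynomials.

(* Main.v *)
Require Import Defs.
From mathcomp Require Import all_boot all_order all_algebra.
From mathcomp Require Import reals complex.
From mathcomp Require Import zify.
Import GRing.Theory Num.Theory.
Local Open Scope ring_scope.

(** The defining relation of the reciprocal operator, written on monomials,
    says [sigma ('X^m * Rec 'X^n) = mu m * tau 'X^(m + n - 1)].  Apart from the
    factor [mu m], the right-hand side only depends on [m + n]; so shifting a
    power of ['X] from one argument to the other turns a linear recurrence for
    [mu] into one for the polynomials [Rec 'X^n]: multiplying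
    [\sum_i alpha i * mu (m - i) = 0] by [tau 'X^(m + n - 1)] gives
    [sigma ('X^l * 'X * \sum_i alpha i *: ('X^(j.+1 - i) * Rec 'X^(n + i))) = 0]
    for all [l], and since [sigma] is nondegenerate
    (lemma [nondegenerate_radical]),
    [\sum_(0 <= i < j.+2) alpha i *: ('X^(j.+1 - i) * Rec 'X^(n + i)) = 0]
    (lemma [reciprocal_recurrence]).

    As [alpha j.+1] is invertible, this expresses [Rec 'X^(n + j.+1)] through
    its [j.+1] predecessors, each multiplied by the power of ['X] that makes up
    for the gap between the exponents.  Hence if each of these predecessors
    [Rec 'X^m] is divisible by ['X^(m - j)], so is the next one; and for
    [m <= j] that divisibility is void.  This bounds the number of diagonals
    below the main one (lemma [reciprocal_low_coef]).

    Above the main diagonal there is only [nu]: by orthogonality [Rec Q_n] is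
    [sigma]-orthogonal to every [P_m] with [m != n.+1], thus a multiple of
    [P_(n.+1)] (lemma [reciprocal_derived]), and [Rec] raises degrees by one
    (lemma [size_reciprocal]). *)

(** * Bases of polynomials and nondegenerate functionals *)

Section Functionals.
Context {C : fieldType}.
Implicit Types (L : {scalar {poly C}}) (P : nat -> {poly C}) (p : {poly C}).

Lemma graded_expansion P (P_size : forall n, size (P n) = n.+1) n p :
  (size p <= n)%N -> exists c : nat -> C, p = \sum_(i < n) c i *: P i.
Proof.
elim: n p => [|n IHn] p.
  by rewrite leqn0 size_poly_eq0 => /eqP->; exists (fun=> 0); rewrite big_ord0.
move=> p_size; set a := p`_n / (P n)`_n.
have Pn_lead : (P n)`_n != 0.
  have := lead_coef_eq0 (P n); rewrite lead_coefE P_size /= => ->.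
  by rewrite -size_poly_eq0 P_size.
have [|c pE] := IHn (p - a *: P n).
  apply/leq_sizeP => i; rewrite leq_eqVlt coefB coefZ => /predU1P[<-|lt_ni].
    by rewrite divfK // subrr.
  rewrite (leq_sizeP _ _ p_size) // (leq_sizeP (P n) n.+1 _) ?P_size //.
  by rewrite mulr0 subr0.
exists (fun i => if (i < n)%N then c i else a).
rewrite big_ord_recr /= ltnn.
under eq_bigr => i _ do rewrite ltn_ord.
by rewrite -pE subrK.
Qed.

(** The coefficient vector of an element of the radical lies in the kernel of
    a Hankel matrix of [L]. *)
Lemma nondegenerate_radical L p :
  nondegenerate_functional L -> (forall n, L ('X^n * p) = 0) -> p = 0.
Proof.
move=> L_nondeg Lp; apply/eqP; rewrite -size_poly_eq0 -leqn0 leqNgt.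
apply/negP => p_gt0; have := L_nondeg _ p_gt0.
set H := matrix_of_fun _ _ => H_det.
have v0 : \row_(i < size p) p`_i = 0.
  have Hunit : H \in unitmx by rewrite unitmxE unitfE.
  rewrite -[LHS](mulmxK Hunit) (_ : _ *m H = 0) ?mul0mx //.
  apply/rowP => k; rewrite !mxE.
  transitivity (L ('X^k * \sum_(i < size p) p`_i *: 'X^i)); last first.
    by rewrite -poly_def coefK.
  rewrite mulr_sumr linear_sum /=.
  apply: eq_bigr => i _; rewrite !mxE /moment -scalerAr -exprD linearZ /=.
  by rewrite addnC.
have lt_p : ((size p).-1 < size p)%N by rewrite prednK.
move/rowP/(_ (Ordinal lt_p)): v0; rewrite !mxE /=.
move/eqP; rewrite -lead_coefE lead_coef_eq0 => /eqP p0.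
by rewrite p0 size_poly0 in p_gt0.
Qed.

Lemma graded_radical L P p :
    nondegenerate_functional L -> (forall n, size (P n) = n.+1) ->
  (forall n, L (P n * p) = 0) -> p = 0.
Proof.
move=> L_nondeg P_size Lp; apply: (nondegenerate_radical L) => // n.
have [c ->] := graded_expansion P P_size (size ('X^n : {poly C})) 'X^n (leqnn _).
rewrite mulr_suml linear_sum big1 // => i _.
by rewrite -scalerAl linearZ /= Lp mulr0.
Qed.

Lemma orthogonal_norm_neq0 L P n :
    nondegenerate_functional L -> (forall n, size (P n) = n.+1) ->
  orthogonal_for L P -> L (P n * P n) != 0.
Proof.
move=> L_nondeg P_size P_orth; apply/eqP => norm0.
have/eqP : P n = 0.
  apply: (graded_radical L P) => // m.
  by case: (eqVneq m n) => [->|/eqP/P_orth].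
by rewrite -size_poly_eq0 P_size.
Qed.

End Functionals.

(** * The derived polynomials and the reciprocal operator *)

Section Reciprocal.
Context {C : fieldType}.
Context {sigma tau : {scalar {poly C}}} {P : nat -> {poly C}} {mu : nat -> C}.
Context {D Rec : {linear {poly C} -> {poly C}}}.
Hypothesis sigma_nondeg : nondegenerate_functional sigma.
Hypothesis P_orth : monic_orthogonal sigma P.
Hypothesis D_gder : generalized_derivative mu D.
Hypothesis tau_nondeg : nondegenerate_functional tau.
Hypothesis Q_orth : orthogonal_for tau (derived_poly mu D P).
Hypothesis Rec_recip : reciprocal_operator sigma tau D Rec.

Local Notation Q := (derived_poly mu D P).

Let P_size n : size (P n) = n.+1. Proof. by case: P_orth => /(_ n)[]. Qed.

Lemma coef_generalized_derivative (p : {poly C}) n : (D p)`_n = mu n.+1 * p`_n.+1.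
Proof.
case: D_gder => mu0 _ DX.
have [N pN nN] : exists2 N, (size p <= N)%N & (n.+1 < N)%N.
  by exists (maxn (size p) n.+2); rewrite leq_max leqnn ?orbT.
have -> : p = \sum_(i < N) p`_i *: 'X^i.
  apply/polyP => i; rewrite -poly_def coef_poly; case: ifP => // /negbT.
  by rewrite -leqNgt => Ni; apply: (leq_sizeP _ _ pN).
rewrite linear_sum /= -poly_def coef_poly nN coef_sum (bigD1 (Ordinal nN)) //=.
rewrite linearZ /= DX /= !coefZ coefXn eqxx mulr1 mulrC big1 ?addr0 //.
move=> [[|i] /= iN] /eqP ne; rewrite linearZ /= DX /= !coefZ coefXn.
  by rewrite mu0 mul0r mulr0.
case: eqP => [ni|_]; last by rewrite !mulr0.
by case: ne; apply: val_inj; rewrite /= ni.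
Qed.

Lemma derived_monic n : Q n \is monic /\ size (Q n) = n.+1.
Proof.
have [_ mu_neq0 _] := D_gder.
have Qn : (Q n)`_n = 1.
  rewrite coefZ coef_generalized_derivative.
  have [/(_ n.+1)[/monicP]] := P_orth; rewrite lead_coefE P_size /= => -> _ _.
  by rewrite mulr1 mulVf ?mu_neq0.
have Q_size : size (Q n) = n.+1.
  apply/eqP; rewrite eqn_leq; apply/andP; split.
    apply/leq_sizeP => i ni; rewrite coefZ coef_generalized_derivative.
    by rewrite (leq_sizeP (P n.+1) n.+2 _) ?P_size // !mulr0.
  rewrite ltnNge; apply/negP => /leq_sizeP/(_ n (leqnn n)).
  by apply/eqP; rewrite Qn oner_neq0.
by split=> //; apply/monicP; rewrite lead_coefE Q_size.
Qed.

Lemma generalized_derivative_P0 : D (P 0) = 0.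
Proof.
apply/polyP => n; rewrite coef_generalized_derivative coef0.
by rewrite (leq_sizeP (P 0) 1 _) ?P_size ?mulr0.
Qed.

Lemma generalized_derivative_P n : D (P n.+1) = mu n.+1 *: Q n.
Proof.
by have [_ mu_neq0 _] := D_gder; rewrite scalerA mulfV ?mu_neq0 ?scale1r.
Qed.

Definition reciprocal_coef n : C :=
  mu n * tau (Q n.-1 * Q n.-1) / sigma (P n * P n).

Let norm_P_neq0 n : sigma (P n * P n) != 0.
Proof. by apply: orthogonal_norm_neq0 => //; case: P_orth. Qed.

Lemma reciprocal_coef_neq0 n : reciprocal_coef n.+1 != 0.
Proof.
have [_ mu_neq0 _] := D_gder.
rewrite /reciprocal_coef !mulf_neq0 ?invr_eq0 ?mu_neq0 //.
by apply: orthogonal_norm_neq0 => // m; case: (derived_monic m).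
Qed.

(** The pairing of [Rec (Q n)] with [P m] is that of [Q n] with
    [D (P m) = mu m *: Q m.-1], so that [Rec (Q n)] has a single nonzero
    coordinate in the basis [P]. *)
Lemma reciprocal_derived n : Rec (Q n) = reciprocal_coef n.+1 *: P n.+1.
Proof.
apply/eqP; rewrite -subr_eq0; apply/eqP.
apply: (graded_radical sigma P) => // m.
rewrite mulrBr linearB /= -Rec_recip -scalerAr linearZ /=.
case: P_orth => _ P_orth0; case: m => [|m].
  by rewrite generalized_derivative_P0 mulr0 linear0 P_orth0 // mulr0 subr0.
rewrite generalized_derivative_P -scalerAr linearZ /=.
case: (eqVneq m n) => [->|ne_mn]; first by rewrite divfK ?subrr.
rewrite Q_orth; last by apply/eqP; rewrite eq_sym.
by rewrite P_orth0 ?mulr0 ?subr0 // => -[]; apply/eqP.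
Qed.

Lemma size_reciprocal n (p : {poly C}) : (size p <= n)%N -> (size (Rec p) <= n.+1)%N.
Proof.
have Q_size m : size (Q m) = m.+1 by case: (derived_monic m).
case/(graded_expansion Q Q_size) => c ->; rewrite linear_sum.
apply: leq_trans (size_sum _ _ _) _; apply/bigmax_leqP => i _.
rewrite linearZ /= reciprocal_derived scalerA.
by apply: leq_trans (size_scale_leq _ _) _; rewrite P_size ltnS.
Qed.

Lemma coef_reciprocal_top n : (Rec 'X^n)`_n.+1 = reciprocal_coef n.+1.
Proof.
have [Q_monic Q_size] := derived_monic n.
rewrite -[X in Rec X](subrK (Q n)) linearD /= reciprocal_derived coefD coefZ.
have [/(_ n.+1)[/monicP]] := P_orth; rewrite lead_coefE P_size /= => -> _ _.
rewrite (leq_sizeP _ n.+1 _) ?mulr1 ?add0r //; apply: size_reciprocal.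
apply/leq_sizeP => i; rewrite leq_eqVlt coefB coefXn => /predU1P[<-|lt_ni].
  by move/monicP: Q_monic; rewrite lead_coefE Q_size eqxx => ->; rewrite subrr.
by rewrite gtn_eqF // (leq_sizeP (Q n) n.+1 _) ?Q_size ?subr0.
Qed.

(** * Transfer of the difference equation *)

Lemma sigma_reciprocal_monomial m n :
  sigma ('X^(m.+1) * Rec 'X^n) = mu m.+1 * tau 'X^(n + m).
Proof.
by have [_ _ DX] := D_gder; rewrite -Rec_recip DX -scalerAr -exprD linearZ.
Qed.

Context {j : nat} {alpha : nat -> C}.
Hypothesis alpha_last : alpha j.+1 != 0.
Hypothesis mu_rec : forall n, (j.+1 < n)%N ->
  \sum_(0 <= i < j.+2) alpha i * mu (n - i)%N = 0.

(** The recurrence for [mu] is only assumed where all its indices are positive;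
    accordingly the orthogonality is obtained for the positive powers of ['X]
    only, whence the radical lemma is applied to ['X] times the sum. *)
Lemma reciprocal_recurrence n :
  \sum_(0 <= i < j.+2) alpha i *: ('X^(j.+1 - i) * Rec 'X^(n + i)) = 0.
Proof.
set U := (U in U = 0).
suff/eqP : 'X * U = 0 by rewrite mulf_eq0 polyX_eq0 => /eqP.
apply: (nondegenerate_radical sigma) => // l.
have /(congr1 (fun x => x * tau 'X^(n + (l + j.+1)))) :
    \sum_(0 <= i < j.+2) alpha i * mu (l.+1 + j.+1 - i)%N = 0.
  by apply: mu_rec; rewrite addSn ltnS leq_addl.
rewrite mul0r => <-; rewrite mulrA -exprSr /U mulr_sumr linear_sum mulr_suml.
apply: eq_big_nat => i; rewrite ltnS => /andP[_ le_ij].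
rewrite -scalerAr linearZ /= mulrA -exprD -addnBA // addSn.
rewrite sigma_reciprocal_monomial mulrA.
by rewrite -addnA [(i + _)%N]addnC -addnA subnK.
Qed.

Lemma reciprocal_low_coef n k : (k + j < n)%N -> (Rec 'X^n)`_k = 0.
Proof.
elim/ltn_ind: n k => n IHn k lt_kj_n.
have le_jn : (j.+1 <= n)%N by apply: leq_ltn_trans lt_kj_n; apply: leq_addl.
have /polyP/(_ k) := reciprocal_recurrence (n - j.+1).
rewrite big_nat_recr //= subnn expr0 mul1r subnK // coefD coefZ coef0 coef_sum.
rewrite big1_seq ?add0r => [|i].
  by move/eqP; rewrite mulf_eq0 (negPf alpha_last) => /eqP.
rewrite mem_index_iota => /= lt_ij; rewrite coefZ coefXnM.
case: ltnP => [|le_k]; first by rewrite mulr0.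
by rewrite IHn ?mulr0 //; lia.
Qed.

Definition reciprocal_diagonal (n k : nat) : C :=
  if (k <= n)%N then (Rec 'X^n)`_(n - k) else 0.

Lemma reciprocal_monomial n :
  Rec 'X^n = reciprocal_coef n.+1 *: 'X^(n.+1)
             + \sum_(0 <= k < j.+1) reciprocal_diagonal n k *: 'X^(n - k).
Proof.
apply/polyP => i; rewrite coefD coefZ coefXn coef_sum.
case: (ltngtP i n.+1) => [lt_in|lt_ni|->]; last first.
- rewrite mulr1 coef_reciprocal_top big1 ?addr0 // => k _.
  by rewrite coefZ coefXn gtn_eqF ?mulr0 // ltnS leq_subr.
- rewrite mulr0 add0r big1 => [|k _]; last first.
    rewrite coefZ coefXn gtn_eqF ?mulr0 //.
    by apply: leq_ltn_trans (leq_subr _ _) (ltnW lt_ni).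
  have /size_reciprocal/leq_sizeP-> // : (size ('X^n : {poly C}) <= n.+1)%N.
  by rewrite size_polyXn.
have le_in : (i <= n)%N by [].
have diag_out k : k <> (n - i)%N ->
    (reciprocal_diagonal n k *: 'X^(n - k))`_i = 0.
  move=> ne_k; rewrite coefZ coefXn /reciprocal_diagonal.
  case: leqP => [le_kn|_]; last by rewrite mul0r.
  by case: eqP => [i_eq|_]; [case: ne_k; rewrite i_eq subKn | rewrite mulr0].
rewrite mulr0 add0r; case: (ltnP (n - i) j.+1) => [lt_j|ge_j].
  rewrite big_mkord (bigD1 (Ordinal lt_j)) //= big1 => [|k /eqP ne_k].
    by rewrite coefZ coefXn /reciprocal_diagonal leq_subr !subKn // eqxx mulr1 addr0.
  by apply: diag_out => k_eq; case: ne_k; apply: val_inj.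
rewrite reciprocal_low_coef -?ltn_subRL // big1_seq // => k.
rewrite mem_index_iota => /= lt_kj; apply: diag_out => k_eq.
by move: lt_kj; rewrite k_eq ltnNge ge_j.
Qed.

End Reciprocal.

Theorem proposition6 (R : realType)
  (sigma tau : {scalar {poly R[i]}}) (P : nat -> {poly R[i]})
  (mu : nat -> R[i]) (D Rec : {linear {poly R[i]} -> {poly R[i]}})
  (j : nat) (alpha : nat -> R[i])
  (sigma_nondeg : nondegenerate_functional sigma)
  (sigma_norm : moment sigma 0 = 1)
  (P_orth : monic_orthogonal sigma P)
  (D_gder : generalized_derivative mu D)
  (tau_nondeg : nondegenerate_functional tau)
  (Q_orth : orthogonal_for tau (derived_poly mu D P))
  (Rec_recip : reciprocal_operator sigma tau D Rec)
  (j_ge1 : (1 <= j)%N)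
  (alpha_first : alpha 0%N != 0)
  (alpha_last : alpha j.+1 != 0)
  (mu_rec : forall n : nat, (j.+1 < n)%N ->
     \sum_(0 <= i < j.+2) alpha i * mu (n - i)%N = 0) :
  exists (nu : nat -> R[i]) (K : nat -> nat -> R[i]),
    [/\ forall n : nat, nu n.+1 != 0,
        forall n : nat, Rec (derived_poly mu D P n) = nu n.+1 *: P n.+1,
        forall n k : nat, (n < k)%N -> K n k = 0
      & forall n : nat,
          Rec 'X^n = nu n.+1 *: 'X^(n.+1)
                     + \sum_(0 <= k < j.+1) K n k *: 'X^(n - k)].
Proof.
exists (@reciprocal_coef _ sigma tau P mu D), (@reciprocal_diagonal _ Rec).
split=> [n|n|n k lt_nk|n].
- exact: reciprocal_coef_neq0.
- exact: reciprocal_derived.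
- by rewrite /reciprocal_diagonal leqNgt lt_nk.
- by apply: reciprocal_monomial alpha_last mu_rec n.
Qed.
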